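(* Fix integers $l\ge 2$ and $l'\ge 2$. Consider an attribute $A$ with concepts $c_1,\dots,c_l$ and an attribute $A'$ with concepts $c'_1,\dots,c'_{l'}$. For each dimension $d$, let $\{v_{i,j}: 1\le i\le l,\ 1\le j\le l'\}$ be independent random vectors with $v_{i,j}\sim N(\mathbf{0},I_d)$ (the representation of the composite concept $\{c_i,c'_j\}$). Define $$\hat v_i=\frac{1}{l'}\sum_{j=1}^{l'}v_{i,j},\qquad \hat v'_j=\frac{1}{l}\sum_{i=1}^{l}v_{i,j},\qquad \mu=\frac{1}{ll'}\sum_{i=1}^{l}\sum_{j=1}^{l'}v_{i,j},$$ and, for a positive scalar $\sigma>0$ (which may depend on $d$), the centered base-concept representations $$v_i=\frac{\hat v_i-\mu}{\sigma}\ (1\le i\le l),\qquad v'_j=\frac{\hat v'_j-\mu}{\sigma}\ (1\le j\le l').$$ Then: (1) Almost surely, there exist $i\neq i'$ in $\{1,\dots,l\}$ with $\langle v_i,v_{i'}\rangle\neq 0$, and there exist $j\neq j'$ in $\{1,\dots,l'\}$ with $\langle v'_j,v'_{j'}\rangle\neq 0$; i.e., within each attribute some pair of base-concept representations is non-orthogonal. (2) For every $i\in\{1,\dots,l\}$, $j\in\{1,\dots,l'\}$ and every $\epsilon>0$, $$\lim_{d\to\infty}\mathbb{P}\Big[v_i\neq 0,\ v'_j\neq 0,\ \Big|\frac{\langle v_i,v'_j\rangle}{\|v_i\|\,\|v'_j\|}\Big|\le\epsilon\Big]=1,$$ i.e., base-concept representations from different attributes are orthogonal with high probability as $d\to\i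nfty$.
   Context: $N(\mathbf{0},I_d)$ denotes the standard (spherical) Gaussian distribution on $\mathbb{R}^d$. $l$ and $l'$ are held fixed as $d\to\infty$. *)

(* Defs.v *)
From HB Require Import structures.
From mathcomp Require Import all_boot all_order all_algebra.
From mathcomp Require Import all_classical all_reals all_analysis.
Set Implicit Arguments. Unset Strict Implicit. Unset Printing Implicit Defensive.
Import Order.TTheory GRing.Theory Num.Theory.
Import numFieldNormedType.Exports.
Local Open Scope classical_set_scope.
Local Open Scope ring_scope.

Definition mutually_independent {d} {T : measurableType d} {R : realType}
  (P : probability T R) {I : finType} (X : I -> T -> R) : Prop :=
  forall (B : I -> set R), (forall a, measurable (B a)) ->
  forall S : {set I},
    P (\bigcap_(a in [set a | a \in S]) (X a @^-1` B a)) =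
    (\prod_(a in S) P (X a @^-1` B a))%E.

Definition std_normal {d} {T : measurableType d} {R : realType}
  (P : probability T R) (X : T -> R) : Prop :=
  forall B : set R, measurable B -> P (X @^-1` B) = normal_prob 0 1 B.

Section vectors.
Variables (R : realType) (l l' n : nat).
Variable x : 'I_l -> 'I_l' -> 'I_n -> R.

Definition vhat (i : 'I_l) : 'rV[R]_n :=
  \row_k ((l'%:R)^-1 * \sum_(j < l') x i j k).
Definition vhat' (j : 'I_l') : 'rV[R]_n :=
  \row_k ((l%:R)^-1 * \sum_(i < l) x i j k).
Definition vmean : 'rV[R]_n :=
  \row_k (((l * l')%:R)^-1 * \sum_(i < l) \sum_(j < l') x i j k).

Definition vbase (sigma : R) (i : 'I_l) : 'rV[R]_n := sigma^-1 *: (vhat i - vmean).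
Definition vbase' (sigma : R) (j : 'I_l') : 'rV[R]_n := sigma^-1 *: (vhat' j - vmean).
End vectors.

Definition dotv {R : realType} {n : nat} (u w : 'rV[R]_n) : R :=
  \sum_(k < n) u 0 k * w 0 k.
Definition normv {R : realType} {n : nat} (u : 'rV[R]_n) : R := Num.sqrt (dotv u u).

(* Main.v *)
Require Import Defs.
From HB Require Import structures.
From mathcomp Require Import all_boot all_order all_algebra.
From mathcomp Require Import all_classical all_reals all_analysis.
From mathcomp Require Import measurable_realfun ring lra.
Import Order.TTheory GRing.Theory Num.Theory.
Import numFieldNormedType.Exports.
Local Open Scope classical_set_scope.
Local Open Scope ring_scope.

(* The centered representations are v_i = sigma^-1 sum_s c_s X_s and
   v'_j = sigma^-1 sum_s c'_s X_s, where s ranges over the pairs of concepts and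
   the weights c_s = ([s.1 = i] - 1/l) / l', c'_s = ([s.2 = j] - 1/l') / l have
   zero sum and are orthogonal to each other.
   (1) The v_i sum to zero, so pairwise orthogonality would force every v_i to
   vanish; but each coordinate of v_i is the sum of an atomless variable and an
   independent one, hence almost surely nonzero.
   (2) By Chebyshev's inequality the Gram entries sum_k X_{s,k} X_{t,k} are
   within d e of d (m^2 + [s = t] v), with m and v the mean and variance of the
   standard normal law, outside an event of probability O(1/d). On the
   complement <v_i, v'_j> is at most a small multiple of d, whereas |v_i|^2 and
   |v'_j|^2 are at least constant multiples of d. Only v > 0 and a finite fourth
   moment are needed, so m and v are never computed. *)

(** * Independence of disjoint groups of variables *)

(** A pi-system generating the sigma-algebra of the variables indexed by [A]. Mutual independence
    gives the product formula on such sets directly, and uniqueness of measures carries it to the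
    generated sigma-algebra. *)
Definition cylinders {I : finType} {T : Type} {R : realType} (X : I -> T -> R)
  (A : {set I}) : set (set T) :=
  [set C | exists2 B : I -> set R, (forall a, measurable (B a)) &
     C = \bigcap_(a in [set a | a \in A]) (X a @^-1` B a)].

Lemma cylinders_setT {I : finType} {T : Type} {R : realType} (X : I -> T -> R)
  (A : {set I}) : cylinders X A setT.
Proof.
exists (fun=> setT) => //.
by apply/esym/seteqP; split.
Qed.

Lemma cylinders_setI {I : finType} {T : Type} {R : realType} (X : I -> T -> R)
  (A : {set I}) : setI_closed (cylinders X A).
Proof.
move=> _ _ [B mB ->] [B' mB' ->]; exists (fun a => B a `&` B' a).
  by move=> a; exact: measurableI.
by rewrite -bigcapI.
Qed.

Lemma cylinders_measurable {I : finType} {d} {T : measurableType d}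
    {R : realType} (X : I -> T -> R) (A : {set I}) :
  (forall a, measurable_fun setT (X a)) -> cylinders X A `<=` measurable.
Proof.
move=> mX _ [B mB ->]; apply: fin_bigcap_measurable => // a _.
by rewrite -[X in measurable X]setTI; exact: mX.
Qed.

Lemma sigma_cylinders_measurable {I : finType} {d} {T : measurableType d}
    {R : realType} (X : I -> T -> R) (A : {set I}) :
  (forall a, measurable_fun setT (X a)) -> <<s cylinders X A >> `<=` measurable.
Proof.
move=> mX; apply: smallest_sub; first exact: sigma_algebra_measurable.
exact: cylinders_measurable.
Qed.

(** For fixed [D], both sides are finite measures in [C]: the restriction of [P] to [D], and [P]
    scaled by the number [P D]. They agree on a pi-system containing the whole space, hence on the
    sigma-algebra it generates. *)
Lemma indep_sigma_l {d} {T : measurableType d} {R : realType}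
    (P : probability T R) (G : set (set T)) (D : set T) :
    G `<=` measurable -> setI_closed G -> G setT -> measurable D ->
    (forall C, G C -> P (C `&` D) = P C * P D)%E ->
  forall C, <<s G >> C -> (P (C `&` D) = P C * P D)%E.
Proof.
move=> mG GI GT mD PG C GC.
have PD0 : 0 <= fine (P D) by rewrite fine_ge0.
have PDE : (fine (P D))%:E = P D by rewrite fineK// fin_num_measure.
have -> : (P C * P D)%E = mscale (NngNum PD0) P C.
  by rewrite muleC -[in LHS]PDE.
apply: (@g_sigma_algebra_measure_unique _ _ _ G mG (fun=> setT) _ _
  (mrestr P mD) (mscale (NngNum PD0) P)) => //.
- by rewrite bigcup_const.
- by move=> B GB; rewrite /= /mrestr PG// muleC -[in LHS]PDE.
- by move=> _; rewrite /= /mrestr setTI (le_lt_trans (probability_le1 _ _))// ltry.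
Qed.

(** Extending from the pi-system to the sigma-algebra once in each argument leaves the case of two
    cylinders. *)
Lemma mutually_independent_groups {I : finType} {d} {T : measurableType d}
    {R : realType} (P : probability T R) (X : I -> T -> R) (A B : {set I}) :
    (forall a, measurable_fun setT (X a)) -> mutually_independent P X ->
    (forall a, a \in A -> a \notin B) ->
  forall C D, <<s cylinders X A >> C -> <<s cylinders X B >> D ->
    (P (C `&` D) = P C * P D)%E.
Proof.
move=> mX iX AB C D AC BD.
apply: (@indep_sigma_l _ _ _ P (cylinders X A)) => //.
- exact: cylinders_measurable.
- exact: cylinders_setI.
- exact: cylinders_setT.
- exact: sigma_cylinders_measurable BD.
move=> {AC} {}C AC; rewrite setIC muleC.
apply: (@indep_sigma_l _ _ _ P (cylinders X B)) => //.
- exact: cylinders_measurable.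
- exact: cylinders_setI.
- exact: cylinders_setT.
- exact: cylinders_measurable AC.
move=> {BD} {}D [b mb ->].
case: AC => a ma ->.
(* As [A] and [B] are disjoint, the two families of sets merge into one, and the intersection
   becomes a single cylinder over the union of [B] and [A]. *)
pose c i := if i \in A then a i else b i.
have mc i : measurable (c i) by rewrite /c; case: ifP.
have bE i : i \in B -> b i = c i.
  by move=> iB; rewrite /c; case: ifP => // iA; have := AB i iA; rewrite iB.
have aE i : i \in A -> a i = c i by move=> iA; rewrite /c iA.
have -> : \bigcap_(i in [set i | i \in B]) (X i @^-1` b i) =
          \bigcap_(i in [set i | i \in B]) (X i @^-1` c i).
  by apply: eq_bigcapr => i /bE ->.
have -> : \bigcap_(i in [set i | i \in A]) (X i @^-1` a i) =
          \bigcap_(i in [set i | i \in A]) (X i @^-1` c i).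
  by apply: eq_bigcapr => i /aE ->.
rewrite -bigcap_setU.
have -> : [set i | i \in B] `|` [set i | i \in A] = [set i | i \in (B :|: A)%SET].
  by apply/seteqP; split=> i /=; rewrite finset.in_setU => /orP.
rewrite !iX//= -bigU /=; last first.
  rewrite fintype.disjoint_subset; apply/fintype.subsetP => i iB.
  by rewrite !inE; apply/negP => /AB; rewrite iB.
by apply: eq_bigl => i; rewrite finset.in_setU.
Qed.

(** Dependence on the variables in [A] alone is phrased as measurability for the generated
    sigma-algebra, so that the closure of measurable functions under sums and products applies. *)
Definition adapted {I : finType} {d} {T : measurableType d} {R : realType}
  (X : I -> T -> R) (A : {set I}) (Y : T -> R) : Prop :=
  measurable_fun (setT : set (g_sigma_algebraType (cylinders X A))) Y.

Lemma adapted_gen {I : finType} {d} {T : measurableType d} {R : realType}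
    (X : I -> T -> R) (A : {set I}) (a : I) : a \in A -> adapted X A (X a).
Proof.
move=> aA _ B mB; apply: sub_sigma_algebra; rewrite setTI.
exists (fun b => if b == a then B else setT); first by move=> b; case: ifP.
apply/seteqP; split => [w /= XB b _ /=|w /(_ a aA)/=]; last by rewrite eqxx.
by case: eqP => // ->.
Qed.

Definition indep2 {d} {T : measurableType d} {R : realType}
  (P : probability T R) (U V : T -> R) : Prop :=
  forall A B, measurable A -> measurable B ->
    (P ((U @^-1` A) `&` (V @^-1` B)) = P (U @^-1` A) * P (V @^-1` B))%E.

Lemma adapted_indep2 {I : finType} {d} {T : measurableType d}
    {R : realType} (P : probability T R) (X : I -> T -> R) (A B : {set I})
    (U V : T -> R) :
    (forall a, measurable_fun setT (X a)) -> mutually_independent P X ->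
    (forall a, a \in A -> a \notin B) -> adapted X A U -> adapted X B V -> indep2 P U V.
Proof.
move=> mX iX AB aU aV C D mC mD.
apply: (mutually_independent_groups P X A B) => //.
- by have := aU measurableT C mC; rewrite setTI.
- by have := aV measurableT D mD; rewrite setTI.
Qed.

Section indep2_joint.
Context {d} {T : measurableType d} {R : realType} (P : probability T R).
Variables U V : {RV P >-> R}.
Hypothesis iUV : indep2 P U V.

Let UV w := (U w, V w).
Let mUV : measurable_fun setT UV.
Proof. exact: measurable_fun_pair. Qed.
HB.instance Definition _ := isMeasurableFun.Build _ _ _ _ UV mUV.

(** Independence is agreement of the two measures on rectangles, which determines the product
    measure. *)
Let joint_law (C : set (R * R)) : measurable C ->
  (distribution P U \x distribution P V)%E C = distribution P UV C.
Proof.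
apply: product_measure_unique => A B mA mB.
by rewrite /= /distribution /pushforward -iUV.
Qed.

(** Under the product law, the line [x + y = 0] has the single point [- x] as its section at [x],
    which is null for the law of [V]; Fubini concludes. *)
Lemma indep2_add_eq0 : (forall r, P (V @^-1` [set r]) = 0%E) ->
  P [set w | U w + V w = 0] = 0%E.
Proof.
move=> V0.
pose C := [set z : R * R | z.1 + z.2 = 0].
have mC : measurable C.
  have -> : C = (fun z : R * R => z.1 + z.2) @^-1` [set 0] by [].
  rewrite -[X in measurable X]setTI.
  have : measurable_fun [set: R * R] (fun z : R * R => z.1 + z.2).
    by apply: measurable_funD; [exact: measurable_fst|exact: measurable_snd].
  by apply.
have -> : P [set w | U w + V w = 0] = distribution P UV C by [].
rewrite -joint_law// /product_measure1 integral0_eq// => x _ /=.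
have -> : xsection C x = [set - x].
  apply/seteqP; split => y; rewrite /xsection/= inE /C/=.
    by move/eqP; rewrite addrC addr_eq0 => /eqP.
  by move=> ->; rewrite subrr.
exact: V0.
Qed.

Lemma indep2_expectationM : P.-integrable setT (EFin \o U) ->
    P.-integrable setT (EFin \o V) ->
  ('E_P[(U \* V)%R] = 'E_P[U] * 'E_P[V])%E.
Proof.
move=> iU iV.
have iU' : (distribution P U).-integrable setT EFin.
  by apply: integrable_pushforward => //; exact: measurable_funP.
have iV' : (distribution P V).-integrable setT EFin.
  by apply: integrable_pushforward => //; exact: measurable_funP.
have mm : measurable_fun [set: R * R] (fun z : R * R => z.1 * z.2).
  apply: measurable_funM.
    exact: measurable_fst.
  exact: measurable_snd.
pose f := EFin \o (fun z : R * R => z.1 * z.2).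
have mf : measurable_fun [set: R * R] (EFin \o (fun z : R * R => z.1 * z.2)).
  exact/measurable_EFinP.
have jE g : (\int[distribution P U \x distribution P V]_z g z =
             \int[distribution P UV]_z g z)%E.
  by apply: eq_measure_integral => C mC _; exact: joint_law.
(* Tonelli: the iterated integral of [|x y|] factors as the product of the first absolute moments of
   [U] and [V], both finite. *)
have ifp : (distribution P U \x distribution P V)%E.-integrable [set: R * R] f.
  apply/(integrable12ltyP _ _ mf).
  under eq_integral => x _.
    under eq_integral => y _ do rewrite /f/= normrM EFinM.
    rewrite ge0_integralZl//; last first.
      by apply/measurable_EFinP; exact: normr_measurable.
    over.
  rewrite ge0_integralZr//; last 2 first.
  - by apply/measurable_EFinP; exact: normr_measurable.
  - exact: integral_ge0.
  rewrite lte_mul_pinfty//.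
  - exact: integral_ge0.
  - rewrite ge0_fin_numE; last exact: integral_ge0.
    by case/integrableP : iU'.
  - by case/integrableP : iV'.
(* The integrand is signed, so changing variables along [UV] requires its integrability under [P];
   this is read off the product law. *)
have ifd : P.-integrable setT (f \o UV).
  apply/integrableP; split; first exact/measurable_EFinP/measurable_funM.
  rewrite -(ge0_integral_distribution UV (f := abse \o f))//;
    [|exact: measurableT_comp|by move=> y; exact: abse_ge0].
  by rewrite -jE; case/integrableP : ifp.
rewrite unlock.
transitivity (\int[distribution P UV]_z f z)%E.
  by rewrite integral_distribution.
rewrite -jE -integral12_prod_meas1//.
have EV : (\int[distribution P V]_y y%:E = \int[P]_w (V w)%:E)%E.
  by rewrite integral_distribution.
have EU : (\int[distribution P U]_y y%:E = \int[P]_w (U w)%:E)%E.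
  by rewrite integral_distribution.
have VE : (\int[P]_w (V w)%:E)%E \is a fin_num by exact: integrable_fin_num.
rewrite -EU -(fineK VE) -integralZr//.
apply: eq_integral => x _; rewrite /fubini_F /=.
under eq_integral => y _ do rewrite /f/= EFinM.
by rewrite integralZl// EV fineK.
Qed.

End indep2_joint.

(** * Weak law of large numbers *)

Section square_integrable.
Context {d} {T : measurableType d} {R : realType} (P : probability T R).

(** Domination by [1 + U ^+ 2], since [2 |u| <= 1 + u ^+ 2]. *)
Lemma integrable_of_sqr (U : {RV P >-> R}) :
  P.-integrable setT (fun w => (U w ^+ 2)%:E) -> P.-integrable setT (EFin \o U).
Proof.
move=> iU; have i1 : P.-integrable setT (fun w => (1 : R)%:E + (U w ^+ 2)%:E)%E.
  by apply: integrableD => //; exact: finite_measure_integrable_cst.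
apply: le_integrable i1 => //=; first exact/measurable_EFinP.
move=> w _; rewrite lee_fin [leRHS]ger0_norm ?addr_ge0 ?sqr_ge0// ler_norml.
by apply/andP; split; have := sqr_ge0 (U w - 1); have := sqr_ge0 (U w + 1);
  rewrite !expr2; lra.
Qed.

Lemma integrable_mul_of_sqr (U V : {RV P >-> R}) :
  P.-integrable setT (fun w => (U w ^+ 2)%:E) ->
  P.-integrable setT (fun w => (V w ^+ 2)%:E) ->
  P.-integrable setT (fun w => (U w * V w)%:E).
Proof.
move=> iU iV.
have iUV : P.-integrable setT (fun w => (U w ^+ 2)%:E + (V w ^+ 2)%:E)%E.
  exact: integrableD.
apply: le_integrable iUV => //=.
  by apply/measurable_EFinP; exact: measurable_funM.
move=> w _; rewrite lee_fin [leRHS]ger0_norm ?addr_ge0 ?sqr_ge0// ler_norml.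
by apply/andP; split; have := sqr_ge0 (U w - V w); have := sqr_ge0 (U w + V w);
  have := sqr_ge0 (U w); have := sqr_ge0 (V w); rewrite !expr2; lra.
Qed.

End square_integrable.

Section weak_law.
Context {d} {T : measurableType d} {R : realType} (P : probability T R).
Variables (n : nat) (Y : 'I_n -> {RV P >-> R}) (C : R).
Hypothesis iY2 : forall k, P.-integrable setT (fun w => (Y k w ^+ 2)%:E).
Hypothesis EY0 : forall k, ('E_P[Y k] = 0)%E.
Hypothesis EY2 : forall k, (\int[P]_w (Y k w ^+ 2)%:E <= C%:E)%E.
Hypothesis indY : forall k k', k != k' -> indep2 P (Y k) (Y k').

Let S w := \sum_(k < n) Y k w.
Let mS : measurable_fun setT S.
Proof. exact: measurable_sum. Qed.
HB.instance Definition _ := isMeasurableFun.Build _ _ _ _ S mS.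

(** In the expanded square, each off-diagonal term has expectation zero by independence and
    centering, so only the [n] diagonal terms count. *)
Let ES2 : (\int[P]_w (S w ^+ 2)%:E <= (n%:R * C)%:E)%E.
Proof.
have iYY k k' : P.-integrable setT (fun w => (Y k w * Y k' w)%:E).
  exact: integrable_mul_of_sqr.
under eq_integral => w _.
  rewrite /S expr2 big_distrlr/= -sumEFin.
  under eq_bigr do rewrite -sumEFin.
  over.
rewrite integral_sum//; last first.
  by move=> k; apply: integrable_sum => // k' _; exact: iYY.
have -> : (n%:R * C)%:E = (\sum_(k < n) C%:E)%E.
  by rewrite sumEFin sumr_const card_ord mulr_natl.
apply: lee_sum => k _.
rewrite integral_sum// (bigD1 k)//= big1 ?adde0.
  by under eq_integral do rewrite -expr2; exact: EY2.
move=> k' k'k.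
have := indep2_expectationM P (Y k) (Y k').
rewrite EY0 mul0e expectation.unlock; apply; last 2 first.
- exact: integrable_of_sqr.
- exact: integrable_of_sqr.
by apply: indY; rewrite eq_sym.
Qed.

Lemma weak_law (eps : R) : 0 < eps ->
  (P [set w | (eps <= `|\sum_(k < n) Y k w|)%R] <= (n%:R * C / eps ^+ 2)%:E)%E.
Proof.
move=> e0.
rewrite EFinM lee_pdivlMr ?exprn_gt0// muleC; apply: le_trans ES2.
apply: le_trans (@markov _ _ _ P S (fun r => r ^+ 2) eps e0 _ _ _) _.
- exact: measurable_funX.
- by move=> r _; exact: sqr_ge0.
- by move=> x y; rewrite !nnegrE => x0 y0; rewrite ler_sqr.
rewrite expectation.unlock; by under eq_integral do rewrite /= real_normK ?num_real//.
Qed.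

End weak_law.

(** * The standard normal law *)

Section density.
Context {d} {T : measurableType d} {R : realType}.
Variables (mu nu : {measure set T -> \bar R}) (g : T -> R).
Hypothesis mg : measurable_fun setT g.
Hypothesis g0 : forall x, 0 <= g x.
Hypothesis nuE : forall A, measurable A -> nu A = (\int[mu]_(x in A) (g x)%:E)%E.

Import HBNNSimple.

Let integral_density_nnsfun (f : {nnsfun T >-> R}) :
  (\int[nu]_x (f x)%:E = \int[mu]_x ((f x)%:E * (g x)%:E))%E.
Proof.
under [LHS]eq_integral do rewrite fimfunE -fsumEFin//.
rewrite [LHS]ge0_integral_fsum//; last 2 first.
- by move=> r; exact/measurable_EFinP/measurableT_comp.
- by move=> n x _; rewrite EFinM nnfun_muleindic_ge0.
under [RHS]eq_integral.
  move=> x xD; rewrite fimfunE -fsumEFin// ge0_mule_fsuml; last first.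
    by move=> r; rewrite EFinM nnfun_muleindic_ge0.
  over.
rewrite [RHS]ge0_integral_fsum//; last 2 first.
- move=> r; apply: emeasurable_funM => //.
  - exact/measurable_EFinP/measurableT_comp.
  - exact/measurable_EFinP.
- move=> n x _; rewrite mule_ge0//; last by rewrite lee_fin.
  by rewrite EFinM nnfun_muleindic_ge0.
apply: eq_fsbigr => r /[!inE] -[x _ <-].
rewrite integralZl_indic_nnsfun//= integral_indic// setIT nuE//.
rewrite -ge0_integralZl//; [|exact/measurable_EFinP/measurable_funTS
                            |by move=> y _; rewrite lee_fin|by rewrite lee_fin].
rewrite [LHS]integral_mkcond/=; apply: eq_integral => y _.
rewrite patchE indicE; case: ifPn => _; first by rewrite mulr1.
by rewrite mulr0 mul0e.
Qed.

(** The formula holds for simple functions by linearity, and passes to nonnegative measurable ones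
    by monotone convergence on both sides. It reduces normal moments to Lebesgue integrals. *)
Lemma ge0_integral_density (f : T -> \bar R) :
    measurable_fun setT f -> (forall x, 0 <= f x)%E ->
  (\int[nu]_x f x = \int[mu]_x (f x * (g x)%:E))%E.
Proof.
move=> mf f0.
pose f_ := nnsfun_approx measurableT mf.
have f_f x : (f_ n x)%:E @[n --> \oo] --> f x by exact: cvg_nnsfun_approx.
have nd x m n : (m <= n)%N -> ((f_ m x)%:E <= (f_ n x)%:E)%E.
  by move=> mn; rewrite lee_fin; exact/lefP/nd_nnsfun_approx.
transitivity (lim (\int[nu]_x (f_ n x)%:E @[n --> \oo])%E).
  rewrite -monotone_convergence//=.
  - by apply: eq_integral => x _; apply/esym/cvg_lim => //=.
  - by move=> n; exact/measurable_EFinP/measurable_funTS.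
  - by move=> n ? _; rewrite lee_fin.
  - by move=> x _ m n mn; exact: nd.
rewrite (_ : (fun n => \int[nu]_x (f_ n x)%:E)%E =
  (fun n => \int[mu]_x ((f_ n x)%:E * (g x)%:E))%E); last first.
  by apply/funext => n; exact: integral_density_nnsfun.
rewrite -monotone_convergence//=.
- apply: eq_integral => x _; apply/cvg_lim => //=.
  by apply: cvgeZr.
- move=> n; apply: emeasurable_funM.
    exact/measurable_EFinP/measurable_funTS.
  exact/measurable_EFinP.
- by move=> n x _; rewrite mule_ge0 ?lee_fin.
- by move=> x _ m n mn; apply: lee_wpmul2r; [rewrite lee_fin|exact: nd].
Qed.
End density.

Lemma integral_exp4_normal_lty (R : realType) :
  (\int[normal_prob 0 (1 : R)]_x (x ^+ 4)%:E < +oo)%E.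
Proof.
rewrite (@ge0_integral_density _ _ _ lebesgue_measure _ (normal_pdf 0 1)) //; last 4 first.
- exact: measurable_normal_pdf.
- exact: normal_pdf_ge0.
- by apply/measurable_EFinP; exact: measurable_funX.
- by move=> x; rewrite lee_fin exprn_even_ge0.
(* The integrand is compared with the density of variance 2, proportional to [expR (- y)] for
   [y = x ^+ 2 / 4]. As [x ^+ 4 = 16 y ^+ 2] and the standard density is proportional to
   [expR (- 2 y)], the claim is [16 y ^+ 2 <= 32 expR y], which follows from
   [1 + y ^+ 2 / 2 <= expR y]. *)
pose s : R := Num.sqrt 2.
have s0 : s != 0 by rewrite sqrtr_eq0 -ltNge.
pose C : R := 32 * normal_peak 1 / normal_peak s.
apply: (@le_lt_trans _ _ (\int[lebesgue_measure]_x (C%:E * (normal_pdf 0 s x)%:E))%E).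
  apply: ge0_le_integral => //.
  - move=> x _; rewrite mule_ge0// lee_fin ?normal_pdf_ge0//.
    by rewrite exprn_even_ge0.
  - apply/measurable_EFinP; apply: measurable_funM; first exact: measurable_funX.
    exact: measurable_normal_pdf.
  - apply/measurable_EFinP; apply: measurable_funM => //.
    exact: measurable_normal_pdf.
  - move=> x _; rewrite -!EFinM lee_fin !normal_pdfE ?oner_eq0//.
    rewrite /normal_fun !subr0 /C.
    have p1 : 0 < normal_peak (1 : R) by rewrite normal_peak_gt0// oner_eq0.
    have ps : 0 < normal_peak s by rewrite normal_peak_gt0.
    set e1 := expR _; set e2 := expR _.
    have -> : 32 * normal_peak 1 / normal_peak s * (normal_peak s * e2) =
              32 * e2 * normal_peak 1 by field; rewrite gt_eqF.
    rewrite [leLHS]mulrCA mulrC ler_pM2r//.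
    pose y := x ^+ 2 / 4.
    have y0 : 0 <= y by rewrite divr_ge0// sqr_ge0.
    have -> : e2 = expR (- y) by rewrite /e2 sqr_sqrtr//; congr expR; rewrite /y; field.
    have -> : e1 = expR (- y) * expR (- y).
      by rewrite /e1 -expRD; congr expR; rewrite /y; field.
    have -> : x ^+ 4 = 16 * y ^+ 2 by rewrite /y; field.
    rewrite mulrA ler_pM2r ?expR_gt0// expRN ler_pdivrMr ?expR_gt0//.
    by have := expR_ge1Dxn 1 y0; rewrite (_ : 2`!%:R = 2 :> R)//; lra.
rewrite ge0_integralZl//; last 3 first.
- by apply/measurable_EFinP; exact: measurable_normal_pdf.
- by move=> x _; rewrite lee_fin normal_pdf_ge0.
- by rewrite lee_fin !mulr_ge0 ?invr_ge0 ?normal_peak_ge0.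
by rewrite integral_normal_pdf mule1 ltry.
Qed.


Lemma normal_prob_set1 (R : realType) (r : R) : normal_prob 0 1 [set r] = 0%E.
Proof. by rewrite /normal_prob integral_set1. Qed.

Definition normal_moment (R : realType) (k : nat) : R :=
  fine (\int[normal_prob 0 1]_x (x ^+ k)%:E)%E.

(** Domination by [1 + x ^+ 4]: the first summand suffices for [|x| <= 1], the second beyond. *)
Lemma integrable_normal_exp (R : realType) (k : nat) : (k <= 4)%N ->
  (normal_prob 0 (1 : R)).-integrable setT (fun x => (x ^+ k)%:E).
Proof.
move=> k4; have i4 : (normal_prob 0 (1 : R)).-integrable setT
    (fun x => (1 : R)%:E + (x ^+ 4)%:E)%E.
  apply: integrableD => //; first exact: finite_measure_integrable_cst.
  apply/integrableP; split; first by apply/measurable_EFinP; exact: measurable_funX.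
  under eq_integral do rewrite gee0_abs ?lee_fin ?exprn_even_ge0//.
  exact: integral_exp4_normal_lty.
apply: le_integrable i4 => //=.
  by apply/measurable_EFinP; exact: measurable_funX.
move=> x _; rewrite lee_fin [leRHS]ger0_norm ?addr_ge0 ?exprn_even_ge0// normrX.
have -> : x ^+ 4 = `|x| ^+ 4 by rewrite -normrX ger0_norm ?exprn_even_ge0.
have [x1|x1] := leP `|x| 1.
  by rewrite (le_trans (exprn_ile1 _ _ _))// lerDl exprn_ge0.
by rewrite (le_trans (ler_weXn2l (ltW x1) k4))// lerDr.
Qed.

Lemma normal_momentE (R : realType) (k : nat) : (k <= 4)%N ->
  (\int[normal_prob 0 1]_x (x ^+ k)%:E)%E = (normal_moment R k)%:E.
Proof.
by move=> k4; rewrite fineK//; apply: integrable_fin_num => //; exact: integrable_normal_exp.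
Qed.

(** A zero variance would concentrate the law at its mean, whereas points are null and the total
    mass is 1. *)
Lemma normal_variance_gt0 (R : realType) :
  0 < normal_moment R 2 - normal_moment R 1 ^+ 2.
Proof.
set m := normal_moment R 1; set N := normal_prob 0 (1 : R).
have i1 := @integrable_normal_exp R 1 isT.
have i2 := @integrable_normal_exp R 2 isT.
have E : (\int[N]_x ((x - m) ^+ 2)%:E = (normal_moment R 2 - m ^+ 2)%:E)%E.
  transitivity (\int[N]_x ((x ^+ 2)%:E + ((- 2 * m)%:E * (x ^+ 1)%:E + (m ^+ 2)%:E)))%E.
    by apply: eq_integral => x _; rewrite -EFinM -!EFinD; congr EFin; ring.
  have iZ : N.-integrable setT (fun x => (- 2 * m)%:E * (x ^+ 1)%:E)%E by exact: integrableZl.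
  have ic : N.-integrable setT (fun x => (m ^+ 2)%:E) by exact: finite_measure_integrable_cst.
  rewrite integralD//; last exact: integrableD.
  rewrite integralD// integralZl// integral_cst//= probability_setT mule1.
  rewrite !normal_momentE// -EFinM -!EFinD; congr EFin; rewrite -/m; ring.
rewrite lt_neqAle; apply/andP; split; last first.
  by rewrite -lee_fin -E integral_ge0// => x _; rewrite lee_fin sqr_ge0.
apply/eqP => v0.
have mf : measurable_fun setT (fun x : R => ((x - m) ^+ 2)%:E).
  by apply/measurable_EFinP; apply: measurable_funX; exact: measurable_funB.
have : ae_eq N setT (fun x => ((x - m) ^+ 2)%:E) (cst 0%E).
  apply/(ae_eq_integral_abs N measurableT mf).
  under eq_integral do rewrite gee0_abs ?lee_fin ?sqr_ge0//.
  by rewrite E -v0.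
move=> [A [mA A0 AN]].
(* Off the null set [A] the square vanishes, so the whole line lies in the union of [A] and the null
   set [[set m]]. *)
have NA : N setT = 0%E.
  apply: (@subset_measure0 _ _ _ N _ (A `|` [set m])) => //.
  - exact: measurableU.
  - move=> x _; have [->|xm] := eqVneq x m; [by right|left; apply: AN => /=].
    by move=> /(_ I) [] /eqP; rewrite sqrf_eq0 subr_eq0 (negbTE xm).
  - apply/eqP; rewrite eq_le measure_ge0 andbT (le_trans (measureU2 _ _ _))//.
    rewrite [X in (X + _)%E](_ : _ = 0%E); last exact: A0.
    rewrite add0e [leLHS](_ : _ = 0%E)//; exact: normal_prob_set1.
have : (1 : \bar R)%E = 0%E by rewrite -(probability_setT N); exact: NA.
by move/eqP; rewrite onee_eq0.
Qed.

Section std_normal_moments.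
Context {d} {T : measurableType d} {R : realType} (P : probability T R).
Variable X : {RV P >-> R}.
Hypothesis hX : std_normal P X.

(* [normal_prob] lives on [measurableTypeR R], whose display differs from the
   one of the target of [X]; [Xs] is [X] with its target relabelled. *)
Let Xs : T -> measurableTypeR R := X.
Let mXs : measurable_fun setT Xs. Proof. exact: (measurable_funP X). Qed.
HB.instance Definition _ := isMeasurableFun.Build _ _ _ _ Xs mXs.

Let law_Xs (f : R -> \bar R) :
  (\int[distribution P Xs]_x f x = \int[normal_prob 0 1]_x f x)%E.
Proof. by apply: eq_measure_integral => B mB _; exact: hX. Qed.

Lemma ge0_integral_std_normal (f : R -> \bar R) :
    measurable_fun setT f -> (forall x, (0 <= f x)%E) ->
  (\int[P]_w f (X w) = \int[normal_prob 0 1]_x f x)%E.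
Proof.
by move=> mf f0; rewrite -law_Xs (ge0_integral_distribution Xs).
Qed.

Lemma integrable_std_normal (k : nat) : (k <= 4)%N ->
  P.-integrable setT (fun w => (X w ^+ k)%:E).
Proof.
move=> k4; apply/integrableP; split.
  by apply/measurable_EFinP; exact: measurable_funX.
rewrite (ge0_integral_std_normal (fun x => `|(x ^+ k)%:E|%E))//.
- by case/integrableP: (integrable_normal_exp R k k4).
- apply/measurable_EFinP; apply: measurableT_comp => //; exact: measurable_funX.
Qed.

Lemma integral_std_normal (k : nat) : (k <= 4)%N ->
  (\int[P]_w (X w ^+ k)%:E = (normal_moment R k)%:E)%E.
Proof.
move=> k4; rewrite -normal_momentE//.
rewrite -law_Xs integral_distribution//; last exact: integrable_std_normal.
by apply/measurable_EFinP; exact: measurable_funX.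
Qed.

End std_normal_moments.

(** * Gram matrices of normal samples *)

(* The value of E[X_s X_t] for an independent standard normal family X. *)
Definition normal_pair_moment (R : realType) {S : eqType} (s t : S) : R :=
  if s == t then normal_moment R 2 else normal_moment R 1 ^+ 2.

Section product_weak_law.
Context {d} {T : measurableType d} {R : realType} (P : probability T R).
Context {S : finType} {n : nat} (X : S -> 'I_n -> {RV P >-> R}).
Hypothesis hX : forall s k, std_normal P (X s k).
Hypothesis iX : mutually_independent P (fun a : S * 'I_n => X a.1 a.2).
Variables s t : S.

Let c := normal_pair_moment R s t.
(** Bounds the second moment of [X_s X_t - c], through [(x y - c) ^+ 2 <= x ^+ 4 + y ^+ 4 + 2 c ^+
    2]. *)
Let C : R := 2 * normal_moment R 4 + 2 * c ^+ 2.

Let F (a : S * 'I_n) : T -> R := X a.1 a.2.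
Let mF a : measurable_fun setT (F a). Proof. exact: measurable_funP. Qed.

Let Y k w := X s k w * X t k w - c.
Let mY k : measurable_fun setT (Y k).
Proof. by apply: measurable_funB => //; exact: measurable_funM. Qed.
HB.instance Definition _ k := isMeasurableFun.Build _ _ _ _ (Y k) (mY k).

Let iX2 r k : P.-integrable setT (fun w => (X r k w ^+ 2)%:E).
Proof. exact: integrable_std_normal. Qed.

Let iXX k : P.-integrable setT (fun w => (X s k w * X t k w)%:E).
Proof. exact: integrable_mul_of_sqr. Qed.

Let EXX k : (\int[P]_w (X s k w * X t k w)%:E = c%:E)%E.
Proof.
rewrite /c /normal_pair_moment; case: eqVneq => [<-|st].
  by rewrite -(integral_std_normal _ _ (hX s k))//; under [LHS]eq_integral do rewrite -expr2.
have iI : indep2 P (X s k) (X t k).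
  apply: (adapted_indep2 P F [set (s, k)]%SET [set (t, k)]%SET) => //.
  - move=> a; rewrite !finset.in_set1 => /eqP ->.
    by apply: contra st => /eqP[->].
  - by apply: (adapted_gen F _ (s, k)); rewrite finset.in_set1.
  - by apply: (adapted_gen F _ (t, k)); rewrite finset.in_set1.
have E1 r : ('E_P[X r k] = (normal_moment R 1)%:E)%E.
  rewrite expectation.unlock -(integral_std_normal _ _ (hX r k))//.
have := indep2_expectationM P _ _ iI (integrable_of_sqr P _ (iX2 s k))
  (integrable_of_sqr P _ (iX2 t k)).
by rewrite !E1 expectation.unlock expr2 EFinM.
Qed.

Let EY k : ('E_P[Y k] = 0)%E.
Proof.
rewrite expectation.unlock.
under eq_integral do rewrite /Y EFinB.
rewrite integralB//; last exact: finite_measure_integrable_cst.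
by rewrite EXX integral_cst//= probability_setT mule1 subee.
Qed.

Let bound k w := (X s k w ^+ 4 + X t k w ^+ 4 + 2 * c ^+ 2)%R.

Let ibound k : P.-integrable setT (EFin \o bound k).
Proof.
have : P.-integrable setT (fun w => (X s k w ^+ 4)%:E + (X t k w ^+ 4)%:E +
    (2 * c ^+ 2)%:E)%E.
  apply: integrableD => //; last exact: finite_measure_integrable_cst.
  by apply: integrableD => //; exact: integrable_std_normal.
by [].
Qed.

Let Ybound k w : Y k w ^+ 2 <= bound k w.
Proof.
rewrite /Y /bound; set x := X s k w; set y := X t k w.
rewrite -subr_ge0.
have -> : x ^+ 4 + y ^+ 4 + 2 * c ^+ 2 - (x * y - c) ^+ 2 =
  (x ^+ 2 - y ^+ 2) ^+ 2 + (x * y + c) ^+ 2 by ring.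
by rewrite addr_ge0 ?sqr_ge0.
Qed.

Let iY2 k : P.-integrable setT (fun w => (Y k w ^+ 2)%:E).
Proof.
apply: le_integrable (ibound k) => //.
  by apply/measurable_EFinP; exact: measurable_funX.
move=> w _; rewrite lee_fin !ger0_norm ?sqr_ge0//.
exact: le_trans (sqr_ge0 _) (Ybound k w).
Qed.

Let EY2 k : (\int[P]_w (Y k w ^+ 2)%:E <= C%:E)%E.
Proof.
apply: (@le_trans _ _ (\int[P]_w (bound k w)%:E)%E).
  apply: le_integral => //; first exact: ibound.
  by move=> w _; rewrite lee_fin.
under eq_integral do rewrite /bound !EFinD.
rewrite integralD//; last exact: finite_measure_integrable_cst.
  rewrite integralD//; [|exact: integrable_std_normal..].
  rewrite !(integral_std_normal _ _ (hX _ _))// integral_cst//= probability_setT mule1.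
  by rewrite -!EFinD lee_fin /C; lra.
by apply: integrableD => //; exact: integrable_std_normal.
Qed.

(** [Y k] involves only variables with coordinate [k], and the blocks of variables for distinct
    coordinates are disjoint. *)
Let indY k k' : k != k' -> indep2 P (Y k) (Y k').
Proof.
move=> kk'.
have aY j : adapted F [set a | a.2 == j]%SET (Y j).
  rewrite /adapted; apply: measurable_funB; last exact: measurable_cst.
  apply: measurable_funM.
    by apply: (adapted_gen F _ (s, j)); rewrite finset.in_set.
  by apply: (adapted_gen F _ (t, j)); rewrite finset.in_set.
apply: (adapted_indep2 P F _ _ _ _ _ _ _ (aY k) (aY k')) => //.
by move=> a; rewrite !finset.in_set => /eqP ->.
Qed.

Lemma weak_law_product (eps : R) : 0 < eps ->
  (P [set w | (eps <= `|\sum_(k < n) (X s k w * X t k w - c)|)%R] <=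
   (n%:R * C / eps ^+ 2)%:E)%E.
Proof. exact: (weak_law P _ Y). Qed.

End product_weak_law.

(** * Weights and the geometry of linear combinations *)

Definition lincomb {R : realType} {S : finType} {n : nat} (r : R) (c : S -> R)
  (x : S -> 'I_n -> R) : 'rV[R]_n := \row_k (r * \sum_s c s * x s k).

Definition row_weight (R : realType) {l l' : nat} (i : 'I_l) (s : 'I_l * 'I_l') : R :=
  ((s.1 == i)%:R - l%:R^-1) / l'%:R.

Definition col_weight (R : realType) {l l' : nat} (j : 'I_l') (s : 'I_l * 'I_l') : R :=
  ((s.2 == j)%:R - l'%:R^-1) / l%:R.

Section weights.
Context {R : realType} {l l' : nat}.
Hypotheses (l0 : (0 < l)%N) (l'0 : (0 < l')%N).

Let lR : l%:R != 0 :> R. Proof. by rewrite pnatr_eq0 -lt0n. Qed.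
Let l'R : l'%:R != 0 :> R. Proof. by rewrite pnatr_eq0 -lt0n. Qed.

Lemma sum_eq_ord (m : nat) (i : 'I_m) (f : 'I_m -> R) :
  \sum_p (p == i)%:R * f p = f i.
Proof.
rewrite (bigD1 i)//= eqxx mul1r big1 ?addr0// => p /negbTE ->.
by rewrite mul0r.
Qed.

Lemma sum_centered_indic (m : nat) (i : 'I_m) :
  \sum_p ((p == i)%:R - m%:R^-1) = 0 :> R.
Proof.
have m0 : m%:R != 0 :> R by rewrite pnatr_eq0; case: m i => // -[].
rewrite sumrB sumr_const card_ord -[_ *+ m]mulr_natl divff//.
by under eq_bigr do rewrite -[_%:R]mulr1; rewrite sum_eq_ord subrr.
Qed.

Lemma sum_centered_indic' (m : nat) (p : 'I_m) :
  \sum_i ((p == i)%:R - m%:R^-1) = 0 :> R.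
Proof.
by under eq_bigr do rewrite eq_sym; exact: sum_centered_indic.
Qed.

Lemma vbaseE (n : nat) (x : 'I_l -> 'I_l' -> 'I_n -> R) (sigma : R) (i : 'I_l) :
  vbase x sigma i = lincomb sigma^-1 (row_weight R i) (fun s k => x s.1 s.2 k).
Proof.
apply/rowP => k; rewrite !mxE; congr (_ * _).
rewrite -(pair_bigA _ (fun p q => row_weight R i (p, q) * x p q k))/= /row_weight/=.
(* Writing row [i] as a Kronecker-weighted sum over all rows turns the partial mean into a double
   sum over all pairs, comparable with the global mean term by term. *)
rewrite -[X in l'%:R^-1 * X](sum_eq_ord _ i (fun p => \sum_j x p j k)).
rewrite !mulr_sumr -sumrB; apply: eq_bigr => p _.
rewrite !mulr_sumr -sumrB; apply: eq_bigr => q _.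
by rewrite natrM; field; rewrite lR l'R.
Qed.

Lemma vbase'E (n : nat) (x : 'I_l -> 'I_l' -> 'I_n -> R) (sigma : R) (j : 'I_l') :
  vbase' x sigma j = lincomb sigma^-1 (col_weight R j) (fun s k => x s.1 s.2 k).
Proof.
apply/rowP => k; rewrite !mxE; congr (_ * _).
rewrite -(pair_bigA _ (fun p q => col_weight R j (p, q) * x p q k))/= /col_weight/=.
rewrite !mulr_sumr -sumrB; apply: eq_bigr => p _.
rewrite -[x p j k](sum_eq_ord _ j (fun q => x p q k)).
rewrite !mulr_sumr -sumrB; apply: eq_bigr => q _.
by rewrite natrM; field; rewrite lR l'R.
Qed.

Lemma sum_row_weight (i : 'I_l) : \sum_(s : 'I_l * 'I_l') row_weight R i s = 0.
Proof.
rewrite -(pair_bigA _ (fun p q => row_weight R i (p, q)))/= exchange_big/=.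
rewrite big1// => q _; rewrite /row_weight/= -mulr_suml.
by rewrite sum_centered_indic mul0r.
Qed.

Lemma sum_col_weight (j : 'I_l') : \sum_(s : 'I_l * 'I_l') col_weight R j s = 0.
Proof.
rewrite -(pair_bigA _ (fun p q => col_weight R j (p, q)))/=.
rewrite big1// => q _; rewrite /col_weight/= -mulr_suml.
by rewrite sum_centered_indic mul0r.
Qed.

(** Source of the relation [sum_i v_i = 0] behind the non-orthogonality claim. *)
Lemma sum_row_weight_idx (s : 'I_l * 'I_l') : \sum_i row_weight R i s = 0.
Proof. by rewrite /row_weight -mulr_suml sum_centered_indic' mul0r. Qed.

Lemma sum_col_weight_idx (s : 'I_l * 'I_l') : \sum_j col_weight R j s = 0.
Proof. by rewrite /col_weight -mulr_suml sum_centered_indic' mul0r. Qed.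

(** The row weight depends on [s.1] only and the column weight on [s.2] only, so the sum over pairs
    separates into centered sums. *)
Lemma sum_row_col_weight (i : 'I_l) (j : 'I_l') :
  \sum_s row_weight R i s * col_weight R j s = 0.
Proof.
rewrite -(pair_bigA _ (fun p q => row_weight R i (p, q) * col_weight R j (p, q)))/=.
rewrite big1// => p _; rewrite /row_weight/col_weight/= -mulr_sumr -mulr_suml.
by rewrite sum_centered_indic mul0r mulr0.
Qed.
End weights.

Section dot.
Context {R : realType} {n : nat}.
Implicit Types u v : 'rV[R]_n.

Lemma dotv_ge0 u : 0 <= dotv u u.
Proof. by apply: sumr_ge0 => k _; rewrite -expr2 sqr_ge0. Qed.

Lemma dotv_gt0 u : (0 < dotv u u) = (u != 0).
Proof.
rewrite lt_neqAle dotv_ge0 andbT eq_sym; congr (~~ _); apply/eqP/eqP => [u0|->].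
  apply/rowP => k; rewrite mxE; apply/eqP; rewrite -sqrf_eq0 expr2; apply/eqP.
  by apply: (psumr_eq0P _ u0) => // k' _; rewrite -expr2 sqr_ge0.
by rewrite /dotv big1// => k _; rewrite mxE mul0r.
Qed.

Lemma dotv0l u : dotv 0 u = 0.
Proof. by rewrite /dotv big1// => k _; rewrite mxE mul0r. Qed.

Lemma dotv_suml (I : finType) (v : I -> 'rV[R]_n) u :
  dotv (\sum_i v i) u = \sum_i dotv (v i) u.
Proof.
rewrite /dotv exchange_big/=; apply: eq_bigr => k _.
by rewrite summxE mulr_suml.
Qed.

(* Pairing [sum_i v_i = 0] with [v_i0] forces [|v_i0|^2 = 0]. *)
Lemma nonorthogonal_of_sum0 (m : nat) (v : 'I_m -> 'rV[R]_n) (i0 : 'I_m) :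
  \sum_i v i = 0 -> v i0 != 0 -> exists i i', i != i' /\ dotv (v i) (v i') != 0.
Proof.
move=> v0 vi0; apply: contrapT => h.
have : 0 < dotv (v i0) (v i0) by rewrite dotv_gt0.
have := dotv_suml _ v (v i0); rewrite v0 dotv0l (bigD1 i0)//= big1 ?addr0.
  by move=> <-; rewrite ltxx.
move=> i ii0; apply/eqP; apply: contrapT => /negP di.
by apply: h; exists i, i0.
Qed.

(** Inner products depend on the sample only through its Gram matrix, hence the laws of large
    numbers for Gram entries. *)
Lemma dotv_lincomb (S : finType) (r : R) (c c' : S -> R) (x : S -> 'I_n -> R) :
  dotv (lincomb r c x) (lincomb r c' x) =
  r ^+ 2 * \sum_s \sum_t c s * c' t * \sum_k x s k * x t k.
Proof.
rewrite /dotv.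
transitivity (\sum_(k < n) r ^+ 2 * \sum_s \sum_t c s * c' t * (x s k * x t k)).
  apply: eq_bigr => k _; rewrite !mxE mulrACA -expr2 big_distrlr/=.
  congr (_ * _); apply: eq_bigr => s _; apply: eq_bigr => t _; ring.
rewrite -mulr_sumr; congr (_ * _); rewrite exchange_big/=; apply: eq_bigr => s _.
by rewrite exchange_big/=; apply: eq_bigr => t _; rewrite mulr_sumr.
Qed.

Lemma sum_lincomb (S I : finType) (r : R) (c : I -> S -> R) (x : S -> 'I_n -> R) :
  (forall s, \sum_i c i s = 0) -> \sum_i lincomb r (c i) x = 0.
Proof.
move=> c0; apply/rowP => k; rewrite summxE mxE.
under eq_bigr do rewrite mxE.
rewrite -mulr_sumr exchange_big/= big1 ?mulr0// => s _.
by rewrite -mulr_suml c0 mul0r.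
Qed.
End dot.

(* Since [sum c = 0], the constant part [m] of the limit Gram matrix
   [m + v * 1%:M] does not contribute. *)
Lemma gram_form_approx (R : realType) (S : finType) (c c' : S -> R)
    (W : S -> S -> R) (N m v e : R) : \sum_s c s = 0 ->
    (forall s t, `|W s t - N * (m + (s == t)%:R * v)| <= N * e) ->
  `|\sum_s \sum_t c s * c' t * W s t - N * v * \sum_s c s * c' s| <=
    N * e * ((\sum_s `|c s|) * \sum_t `|c' t|).
Proof.
move=> c0 We.
have -> : \sum_s \sum_t c s * c' t * W s t - N * v * \sum_s c s * c' s =
  \sum_s \sum_t c s * c' t * (W s t - N * (m + (s == t)%:R * v)).
  have E1 : \sum_s \sum_t c s * c' t * (N * m) = 0.
    transitivity ((\sum_s c s) * \sum_t c' t * (N * m)); last by rewrite c0 mul0r.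
    rewrite big_distrlr/=; apply: eq_bigr => s _; apply: eq_bigr => t _.
    by rewrite -mulrA.
  have E2 : \sum_s \sum_t c s * c' t * (N * ((s == t)%:R * v)) =
            N * v * \sum_s c s * c' s.
    rewrite mulr_sumr; apply: eq_bigr => s _.
    rewrite (bigD1 s)//= eqxx mul1r big1 ?addr0; first by ring.
    by move=> t ts; rewrite eq_sym (negbTE ts) mul0r !mulr0.
  transitivity (\sum_s \sum_t c s * c' t * W s t -
    \sum_s \sum_t c s * c' t * (N * m) -
    \sum_s \sum_t c s * c' t * (N * ((s == t)%:R * v))).
    by rewrite E1 E2 subr0.
  rewrite -!sumrB; apply: eq_bigr => s _; rewrite -!sumrB.
  by apply: eq_bigr => t _; ring.
rewrite big_distrlr/= mulr_sumr (le_trans (ler_norm_sum _ _ _))//.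
apply: ler_sum => s _; rewrite mulr_sumr (le_trans (ler_norm_sum _ _ _))//.
apply: ler_sum => t _; rewrite !normrM mulrC.
by apply: ler_wpM2r => //; rewrite mulr_ge0.
Qed.

(** * Almost sure and asymptotic statements *)

Lemma probability_bigsetU_le {d} {T : measurableType d} {R : realType}
    (P : probability T R) (I : Type) (s : seq I) (A : I -> set T) :
    (forall a, measurable (A a)) ->
  (P (\big[setU/set0]_(a <- s) A a) <= \sum_(a <- s) P (A a))%E.
Proof.
move=> mA; elim: s => [|a s IH]; first by rewrite !big_nil measure0.
rewrite !big_cons (le_trans (measureU2 _ _ _))// ?leeD//.
by apply: bigsetU_measurable.
Qed.

(** At threshold [n e], Chebyshev bounds the deviation of one Gram entry by
    [n C / (n e) ^+ 2 = (C / e ^+ 2) / n]. This is the coefficient of [1 / n] after a union bound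
    over all pairs. *)
Definition gram_tail_cst (R : realType) (S : finType) (e : R) : R :=
  \sum_(a : S * S)
    (2 * normal_moment R 4 + 2 * normal_pair_moment R a.1 a.2 ^+ 2) / e ^+ 2.

Section gram.
Context {d} {T : measurableType d} {R : realType} (P : probability T R).
Context {S : finType} {n : nat} (X : S -> 'I_n -> {RV P >-> R}).
Hypothesis hX : forall s k, std_normal P (X s k).
Hypothesis iX : mutually_independent P (fun a : S * 'I_n => X a.1 a.2).

(** Confines the randomness to one event [U] of probability [O(1/n)]; the estimates on its
    complement are deterministic. *)
Lemma gram_tail (e : R) : 0 < e -> (0 < n)%N -> exists U : set T,
  [/\ measurable U, (P U <= (gram_tail_cst R S e / n%:R)%:E)%E &
   forall w, ~ U w -> forall s t,
     `|\sum_k X s k w * X t k w - n%:R * normal_pair_moment R s t| <= n%:R * e].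
Proof.
move=> e0 n0.
have nR : 0 < n%:R :> R by rewrite ltr0n.
pose f (a : S * S) w :=
  `|\sum_k (X a.1 k w * X a.2 k w - normal_pair_moment R a.1 a.2)|.
pose A a := [set w | n%:R * e <= f a w].
have mA a : measurable (A a).
  rewrite -[A a]setTI; apply: measurable_fun_le => //.
  apply: measurableT_comp => //; apply: measurable_sum => k.
  by apply: measurable_funB => //; exact: measurable_funM.
exists (\big[setU/set0]_a A a); split.
- by apply: bigsetU_measurable.
- apply: le_trans (probability_bigsetU_le P _ _ A mA) _.
  rewrite /gram_tail_cst mulr_suml -sumEFin; apply: lee_sum => a _.
  apply: (le_trans (weak_law_product P X hX iX a.1 a.2 (n%:R * e) (mulr_gt0 nR e0))).
  rewrite lee_fin le_eqVlt; apply/orP; left; apply/eqP; field.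
  by rewrite !gt_eqF.
move=> w Uw s t.
have /negP : ~ A (s, t) w.
  by move=> Aw; apply: Uw; rewrite (bigD1 (s, t))//=; left.
rewrite -ltNge => /ltW; apply: le_trans.
by rewrite /f/= sumrB sumr_const card_ord mulr_natl.
Qed.

Lemma sum_weighted_eq0_null (c : S -> R) (s0 : S) (k : 'I_n) : c s0 != 0 ->
  P [set w | \sum_s c s * X s k w = 0] = 0%E.
Proof.
move=> cs0.
pose F (a : S * 'I_n) : T -> R := X a.1 a.2.
(* The term with nonzero weight is atomless and independent of the remaining sum, so their total
   vanishes with probability zero. *)
pose U w := \sum_(s | s != s0) c s * X s k w.
pose V w := c s0 * X s0 k w.
have UE : U = fun w => \sum_s if s != s0 then c s * X s k w else 0.
  by apply/funext => w; rewrite /U big_mkcond.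
have mU : measurable_fun setT U.
  rewrite UE.
  apply: measurable_sum => s; case: (s != s0) => //; exact: measurable_funM.
have mV : measurable_fun setT V by exact: measurable_funM.
pose U' : {RV P >-> R} := HB.pack U (isMeasurableFun.Build _ _ _ _ U mU).
pose V' : {RV P >-> R} := HB.pack V (isMeasurableFun.Build _ _ _ _ V mV).
have iUV : indep2 P U' V'.
  apply: (adapted_indep2 P F [set a | a.1 != s0]%SET [set a | a.1 == s0]%SET) => //.
  - by move=> a; rewrite !finset.in_set.
  - suff : adapted F [set a | a.1 != s0]%SET U by [].
    rewrite UE; apply: measurable_sum => s; case: (boolP (s != s0)) => [ss0|_];
      last exact: measurable_cst.
    apply: measurable_funM; first exact: measurable_cst.
    by apply: (adapted_gen F _ (s, k)); rewrite finset.in_set.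
  - suff : adapted F [set a | a.1 == s0]%SET V by [].
    apply: measurable_funM; first exact: measurable_cst.
    by apply: (adapted_gen F _ (s0, k)); rewrite finset.in_set.
have V0 r : P (V' @^-1` [set r]) = 0%E.
  have -> : V' @^-1` [set r] = X s0 k @^-1` [set r / c s0].
    apply/seteqP; split => w /=; rewrite /V.
      by move=> <-; rewrite mulrAC divff// mul1r.
    by move=> ->; rewrite mulrC divfK.
  by rewrite hX// normal_prob_set1.
rewrite -[RHS](indep2_add_eq0 P U' V' iUV V0); congr (P _).
have UV w : \sum_s c s * X s k w = U w + V w by rewrite (bigD1 s0)//= addrC.
by apply/seteqP; split => w /=; rewrite UV.
Qed.

(** A vanishing vector has a vanishing first coordinate, which exists because [0 < n], and that is
    already a null event. *)
Lemma lincomb_neq0_ae (r : R) (c : S -> R) (s0 : S) : (0 < n)%N -> r != 0 ->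
  c s0 != 0 -> {ae P, forall w, lincomb r c (fun s k => X s k w) != 0}.
Proof.
move=> n0 r0 cs0; pose k := Ordinal n0.
exists [set w | \sum_s c s * X s k w = 0]; split.
- rewrite -[X in measurable X]setTI.
  have mf : measurable_fun setT (fun w => \sum_s c s * X s k w).
    by apply: measurable_sum => s; exact: measurable_funM.
  by apply: (mf measurableT [set 0]); exact: measurable_set1.
- exact: sum_weighted_eq0_null cs0.
- move=> w /= /negP; rewrite negbK => /eqP /rowP /(_ k); rewrite !mxE.
  by move=> /eqP; rewrite mulf_eq0 (negbTE r0) => /eqP.
Qed.

Lemma measurable_dotv_lincomb (r : R) (c c' : S -> R) :
  measurable_fun setT (fun w => dotv (lincomb r c (fun s k => X s k w))
                                     (lincomb r c' (fun s k => X s k w))).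
Proof.
under eq_fun do rewrite dotv_lincomb.
apply: measurable_funM => //; apply: measurable_sum => s; apply: measurable_sum => t.
apply: measurable_funM => //; apply: measurable_sum => k.
exact: measurable_funM.
Qed.

End gram.

(** The tolerance [e] is chosen before [n], [x] and [r], hence serves all dimensions and all
    scalings at once. *)
Lemma small_cosine (R : realType) (S : finType) (c c' : S -> R) (m v eps : R) :
    \sum_s c s = 0 -> \sum_s c' s = 0 -> \sum_s c s * c' s = 0 ->
    0 < \sum_s c s * c s -> 0 < \sum_s c' s * c' s -> 0 < v -> 0 < eps ->
  exists2 e : R, 0 < e & forall (n : nat) (x : S -> 'I_n -> R) (r : R),
    (0 < n)%N -> r != 0 ->
    (forall s t, `|\sum_k x s k * x t k - n%:R * (m + (s == t)%:R * v)| <= n%:R * e) ->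
    [/\ lincomb r c x != 0, lincomb r c' x != 0 &
     `|dotv (lincomb r c x) (lincomb r c' x) /
       (normv (lincomb r c x) * normv (lincomb r c' x))| <= eps].
Proof.
move=> c0 c'0 cc' a0 b0 v0 eps0.
set a := (X in 0 < X) in a0; set b := (X in 0 < X) in b0.
pose Kc := \sum_s `|c s|; pose Kc' := \sum_s `|c' s|.
(* Half of the smaller limit of the two squared norms, per coordinate and before scaling by [r]:
   errors up to [g] still leave at least [g]. *)
pose g := v * Num.min a b / 2.
have g0 : 0 < g by rewrite !mulr_gt0// lt_min a0.
have ga : 2 * g <= v * a.
  by rewrite /g mulrC mulfVK// ler_pM2l// ge_min lexx.
have gb : 2 * g <= v * b.
  by rewrite /g mulrC mulfVK// ler_pM2l// ge_min lexx orbT.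
have Kc0 : 0 <= Kc by apply: sumr_ge0.
have Kc'0 : 0 <= Kc' by apply: sumr_ge0.
(* Dominates the products of l1 norms by which [gram_form_approx] multiplies the error; the added 1
   makes it positive. *)
pose K := Kc * Kc + Kc * Kc' + Kc' * Kc' + 1.
have h1 : 0 <= Kc * Kc by rewrite mulr_ge0.
have h2 : 0 <= Kc * Kc' by rewrite mulr_ge0.
have h3 : 0 <= Kc' * Kc' by rewrite mulr_ge0.
have K0 : 0 < K by rewrite /K; lra.
(* The factor [Num.min 1 eps] gives both [e K <= g], for the norms, and [e K <= eps g], for the
   inner product. *)
pose e := Num.min 1 eps * g / K.
have m0 : 0 < Num.min 1 eps by rewrite lt_min ltr01 eps0.
have e0 : 0 < e by exact: divr_gt0 (mulr_gt0 m0 g0) K0.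
have eK : e * K = Num.min 1 eps * g by rewrite /e mulfVK// gt_eqF.
have eK1 : e * K <= g by rewrite eK ler_piMl ?(ltW g0)// ge_min lexx.
have eKe : e * K <= eps * g by rewrite eK ler_pM2r// ge_min lexx orbT.
clearbody e g; exists e => // n x r n0 r0 We.
have nR : 0 < n%:R :> R by rewrite ltr0n.
have r20 : 0 < r ^+ 2 by rewrite exprn_even_gt0.
have low (u : S -> R) : \sum_s u s = 0 -> 2 * g <= v * \sum_s u s * u s ->
    e * ((\sum_s `|u s|) * (\sum_s `|u s|)) <= e * K ->
    r ^+ 2 * (n%:R * g) <= dotv (lincomb r u x) (lincomb r u x).
  move=> u0 gu eu; rewrite dotv_lincomb ler_pM2l//.
  have := gram_form_approx _ _ u u _ _ _ _ _ u0 We.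
  rewrite ler_distl => /andP[h _]; apply: le_trans h.
  rewrite -!mulrA -mulrBr ler_pM2l//.
  lra.
have Nc : r ^+ 2 * (n%:R * g) <= dotv (lincomb r c x) (lincomb r c x).
  by apply: low => //; rewrite ler_pM2l// /K -/Kc; lra.
have Nc' : r ^+ 2 * (n%:R * g) <= dotv (lincomb r c' x) (lincomb r c' x).
  by apply: low => //; rewrite ler_pM2l// /K -/Kc'; lra.
have p0 : 0 < r ^+ 2 * (n%:R * g) by exact: mulr_gt0 r20 (mulr_gt0 nR g0).
(* The weights are orthogonal, so the main term vanishes and only the Gram error remains. *)
have D : `|dotv (lincomb r c x) (lincomb r c' x)| <= eps * (r ^+ 2 * (n%:R * g)).
  rewrite dotv_lincomb normrM gtr0_norm// mulrCA ler_pM2l//.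
  have := gram_form_approx _ _ c c' _ _ _ _ _ c0 We.
  rewrite cc' mulr0 subr0 => /le_trans; apply.
  rewrite -mulrA [leRHS]mulrCA ler_pM2l//; apply: le_trans eKe.
  by rewrite ler_pM2l// /K -/Kc -/Kc'; lra.
split; [by rewrite -dotv_gt0 (lt_le_trans p0)|by rewrite -dotv_gt0 (lt_le_trans p0)|].
have nn : r ^+ 2 * (n%:R * g) <= normv (lincomb r c x) * normv (lincomb r c' x).
  rewrite -[leLHS](sqr_sqrtr (ltW p0)) expr2.
  by apply: ler_pM; rewrite ?sqrtr_ge0// ler_sqrt// (le_trans (ltW p0)).
rewrite normf_div [`|_ * _|]ger0_norm ?mulr_ge0 ?sqrtr_ge0//.
rewrite ler_pdivrMr ?(lt_le_trans p0)// (le_trans D)//.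
by rewrite ler_pM2l.
Qed.

(** Nonvanishing is positivity of the squared norm, and there the denominator can be cleared; the
    event becomes a conjunction of inequalities between measurable real functions. *)
Lemma measurable_small_cosine {d} {T : measurableType d} {R : realType}
    {n : nat} (u v : T -> 'rV[R]_n) (eps : R) :
    measurable_fun setT (fun w => dotv (u w) (u w)) ->
    measurable_fun setT (fun w => dotv (v w) (v w)) ->
    measurable_fun setT (fun w => dotv (u w) (v w)) ->
  measurable [set w | [/\ u w != 0, v w != 0 &
    `|dotv (u w) (v w) / (normv (u w) * normv (v w))| <= eps]].
Proof.
move=> mu mv muv.
have msqrt f : measurable_fun setT f -> measurable_fun setT (fun w : T => Num.sqrt (f w : R)).
  move=> mf; apply: measurableT_comp => //.
  exact: (continuous_measurable_fun (@sqrt_continuous R)).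
rewrite (_ : [set w | _] = [set w | (0 < dotv (u w) (u w)) && (0 < dotv (v w) (v w)) &&
  (`|dotv (u w) (v w)| <= eps * (normv (u w) * normv (v w)))]).
  rewrite -[X in measurable X]setTI.
  have mb : measurable_fun setT (fun w => (0 < dotv (u w) (u w)) && (0 < dotv (v w) (v w)) &&
    (`|dotv (u w) (v w)| <= eps * (normv (u w) * normv (v w)))).
    apply: measurable_and; first by apply: measurable_and; exact: measurable_fun_ltr.
    apply: measurable_fun_ler; first exact: measurableT_comp.
    by apply: measurable_funM => //; apply: measurable_funM; exact: msqrt.
  by apply: (mb measurableT [set true]).
apply/seteqP; split => w /=; rewrite !dotv_gt0.
  move=> [u0 v0]; rewrite u0 v0/= normf_div [`|_ * _|]ger0_norm ?mulr_ge0 ?sqrtr_ge0//.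
  by rewrite ler_pdivrMr// mulr_gt0// sqrtr_gt0 dotv_gt0.
move=> /andP[/andP[u0 v0] uv]; split => //.
rewrite normf_div [`|_ * _|]ger0_norm ?mulr_ge0 ?sqrtr_ge0//.
by rewrite ler_pdivrMr// mulr_gt0// sqrtr_gt0 dotv_gt0.
Qed.

(** The weight is [(1 - 1/l) / l'], nonzero because [l] differs from 1. *)
Lemma row_weight_neq0 (R : realType) (l l' : nat) (i : 'I_l) (j : 'I_l') :
  (1 < l)%N -> row_weight R i (i, j) != 0.
Proof.
move=> l1; have l0 : (0 < l)%N := ltnW l1.
have l'0 : (0 < l')%N := leq_ltn_trans (leq0n j) (ltn_ord j).
rewrite /row_weight/= eqxx mulf_neq0 ?invr_eq0 ?pnatr_eq0 -?lt0n//.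
by rewrite subr_eq0 eq_sym invr_eq1 pnatr_eq1 gtn_eqF.
Qed.

Lemma col_weight_neq0 (R : realType) (l l' : nat) (i : 'I_l) (j : 'I_l') :
  (1 < l')%N -> col_weight R j (i, j) != 0.
Proof.
move=> l1; have l'0 : (0 < l')%N := ltnW l1.
have l0 : (0 < l)%N := leq_ltn_trans (leq0n i) (ltn_ord i).
rewrite /col_weight/= eqxx mulf_neq0 ?invr_eq0 ?pnatr_eq0 -?lt0n//.
by rewrite subr_eq0 eq_sym invr_eq1 pnatr_eq1 gtn_eqF.
Qed.

Lemma sum_sqr_gt0 (R : realType) (S : finType) (c : S -> R) (s0 : S) :
  c s0 != 0 -> 0 < \sum_s c s * c s.
Proof.
move=> c0; rewrite (bigD1 s0)//= ltr_wpDr//.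
  by apply: sumr_ge0 => s _; rewrite -expr2 sqr_ge0.
by rewrite -expr2 exprn_even_gt0.
Qed.

Theorem theorem1 (R : realType) (l l' : nat) (hl : (2 <= l)%N) (hl' : (2 <= l')%N)
  (dsp : nat -> measure_display) (T : forall n : nat, measurableType (dsp n))
  (P : forall n : nat, probability (T n) R)
  (X : forall n : nat, 'I_l -> 'I_l' -> 'I_n -> {RV (P n) >-> R})
  (sigma : nat -> R) (hsigma : forall n, 0 < sigma n)
  (hnormal : forall n i j k, std_normal (P n) (X n i j k))
  (hindep : forall n, mutually_independent (P n)
      (fun a : 'I_l * 'I_l' * 'I_n => X n a.1.1 a.1.2 a.2)) :
  (forall n : nat, (0 < n)%N ->
     {ae P n, forall w,
        (exists i i' : 'I_l, i != i' /\
           dotv (vbase (fun i j k => X n i j k w) (sigma n) i)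
                (vbase (fun i j k => X n i j k w) (sigma n) i') != 0) /\
        (exists j j' : 'I_l', j != j' /\
           dotv (vbase' (fun i j k => X n i j k w) (sigma n) j)
                (vbase' (fun i j k => X n i j k w) (sigma n) j') != 0)}) /\
  (forall (i : 'I_l) (j : 'I_l') (eps : R), 0 < eps ->
     (fun n : nat => P n [set w |
        let v := vbase (fun i j k => X n i j k w) (sigma n) i in
        let v' := vbase' (fun i j k => X n i j k w) (sigma n) j in
        [/\ v != 0, v' != 0 & `| dotv v v' / (normv v * normv v') | <= eps]])
     @ \oo --> 1%E).
Proof.
have l0 : (0 < l)%N := ltnW hl.
have l'0 : (0 < l')%N := ltnW hl'.
pose Xs n (s : 'I_l * 'I_l') k := X n s.1 s.2 k.
have hXs n s k : std_normal (P n) (Xs n s k) by exact: hnormal.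
have iXs n : mutually_independent (P n) (fun a : 'I_l * 'I_l' * 'I_n => Xs n a.1 a.2).
  exact: hindep.
have s0 n : (sigma n)^-1 != 0 by rewrite invr_eq0 gt_eqF.
split=> [n n0|i j eps eps0].
  pose i0 := Ordinal l0; pose j0 := Ordinal l'0.
  have := lincomb_neq0_ae (P n) (Xs n) (hXs n) (iXs n) _ _ (i0, j0) n0 (s0 n)
    (row_weight_neq0 R l l' i0 j0 hl).
  have := lincomb_neq0_ae (P n) (Xs n) (hXs n) (iXs n) _ _ (i0, j0) n0 (s0 n)
    (col_weight_neq0 R l l' i0 j0 hl').
  apply: filterS2 => w col row; split.
    apply: (nonorthogonal_of_sum0 _ _ i0); last by rewrite vbaseE.
    under eq_bigr do rewrite vbaseE//.
    by apply: sum_lincomb => s; exact: sum_row_weight_idx.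
  apply: (nonorthogonal_of_sum0 _ _ j0); last by rewrite vbase'E.
  under eq_bigr do rewrite vbase'E//.
  by apply: sum_lincomb => s; exact: sum_col_weight_idx.
(* With the squared mean as [m] and the variance as [v], the quantity [m + (s == t)%:R * v] is
   exactly [normal_pair_moment R s t]. *)
have [e e0 cosP] := small_cosine R _ (row_weight R i) (col_weight R j)
  (normal_moment R 1 ^+ 2) (normal_moment R 2 - normal_moment R 1 ^+ 2) eps
  (sum_row_weight i) (sum_col_weight j) (sum_row_col_weight i j)
  (sum_sqr_gt0 R _ _ (i, j) (row_weight_neq0 R l l' i j hl))
  (sum_sqr_gt0 R _ _ (i, j) (col_weight_neq0 R l l' i j hl'))
  (normal_variance_gt0 R) eps0.
set B := gram_tail_cst R ('I_l * 'I_l')%type e.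
pose Tn n := [set w |
  let v := vbase (fun i j k => X n i j k w) (sigma n) i in
  let v' := vbase' (fun i j k => X n i j k w) (sigma n) j in
  [/\ v != 0, v' != 0 & `| dotv v v' / (normv v * normv v') | <= eps]].
have TnE n : Tn n = [set w |
    let v := lincomb (sigma n)^-1 (row_weight R i) (fun s k => Xs n s k w) in
    let v' := lincomb (sigma n)^-1 (col_weight R j) (fun s k => Xs n s k w) in
    [/\ v != 0, v' != 0 & `| dotv v v' / (normv v * normv v') | <= eps]].
  by apply/seteqP; split => w; rewrite /Tn/= !vbaseE// !vbase'E.
have mTn n : measurable (Tn n).
  by rewrite TnE; apply: measurable_small_cosine; exact: measurable_dotv_lincomb.
have lower n : (0 < n)%N -> ((1 - B / n%:R)%:E <= P n (Tn n))%E.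
  move=> n0; have [U [mU PU UW]] := gram_tail (P n) (Xs n) (hXs n) (iXs n) e e0 n0.
  apply: (@le_trans _ _ (P n (~` U))).
    by rewrite probability_setC// EFinB leeB.
  apply: le_measure; rewrite ?inE//; first exact: measurableC.
  move=> w Uw; rewrite TnE; apply: cosP => // s t.
  have := UW w Uw s t; rewrite /normal_pair_moment.
  by case: eqVneq => _; rewrite ?mul1r ?mul0r ?addr0// addrCA subrr addr0.
(* Dimension 0 is shifted away: there all vectors are zero and the event is empty, while [B / 0 = 0]
   would make the lower bound 1. After the shift, [1 / n.+1] is [harmonic n]. *)
suff : (fun n => P n.+1 (Tn n.+1)) @ \oo --> (1%E : \bar R).
  by rewrite (cvg_shiftS (fun n => P n (Tn n))).
apply: (squeeze_cvge (f := fun n => (1 - B * harmonic n)%:E) (h := fun=> 1%E)).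
- by apply: nearW => n; rewrite probability_le1 ?andbT; [exact: lower|exact: mTn].
- apply: cvg_EFin; first exact: nearW.
  have : 1 - B * harmonic n @[n --> \oo] --> 1 - B * 0.
    by apply: cvgB; [|apply: cvgM]; [exact: cvg_cst..|exact: cvg_harmonic].
  by rewrite mulr0 subr0.
- exact: cvg_cst.
Qed.
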